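(* Let $G$ be a finite, simple, undirected, 2-edge-connected graph. If $$\delta(G)>\frac{\alpha(G)+4}{2},$$ then $G$ is a $P_{\geq3}$-factor uniform graph; that is, for every edge $e\in E(G)$ and every edge $e'\in E(G)\setminus\{e\}$, the graph $G-e$ has a $P_{\geq3}$-factor containing $e'$.
   Context: $\delta(G)$ denotes the minimum degree of $G$ and $\alpha(G)$ its independence number (maximum size of a set of pairwise nonadjacent vertices). For a graph $H$ and $e\in E(H)$, $H-e$ is the graph obtained by deleting the edge $e$. A $P_{\geq3}$-factor of a graph $H$ is a spanning subgraph of $H$ each of whose connected components is a path with at least $3$ vertices. A graph $H$ is a $P_{\geq3}$-factor covered graph if for every edge $f\in E(H)$, $H$ has a $P_{\geq3}$-factor containing $f$. A graph $G$ is a $P_{\geq3}$-factor uniform graph if $G-e$ is a $P_{\geq3}$-factor covered graph for every $e\in E(G)$ (equivalently, for any two edges $e_1,e_2$ of $G$, $G$ has a $P_{\geq3}$-factor containing $e_1$ and avoiding $e_2$). *)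

(* Defs.v *)
From mathcomp Require Import all_boot all_order all_algebra.

Set Implicit Arguments.
Unset Strict Implicit.
Unset Printing Implicit Defensive.

Structure sgraph (T : finType) := SGraph {
  adj :> rel T;
  adj_sym : symmetric adj;
  adj_irrefl : irreflexive adj }.

Section Graphs.
Variable T : finType.
Implicit Types (G F : sgraph T) (D : {set {set T}}) (e f A C : {set T}).

(* An edge is the two-element set of its ends. *)
Definition edges G : {set {set T}} :=
  [set [set u.1; u.2] | u : T * T & G u.1 u.2].

Definition degree G (x : T) : nat := #|[set y | G x y]|.

(* The neutral element #|T| exceeds every degree, so that it does not affect
   the minimum when T is inhabited. *)
Definition min_degree G : nat := \big[minn/#|T|]_(x : T) degree G x.

Definition independent G A : bool := [forall x in A, forall y in A, ~~ G x y].

Definition independence_number G : nat :=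
  \max_(A : {set T} | independent G A) #|A|.

Definition del_rel G D : rel T := [rel x y | G x y && ([set x; y] \notin D)].

Lemma del_rel_sym G D : symmetric (del_rel G D).
Proof. by move=> x y; rewrite /del_rel /= (adj_sym G) setUC. Qed.

Lemma del_rel_irrefl G D : irreflexive (del_rel G D).
Proof. by move=> x; rewrite /del_rel /= (adj_irrefl G). Qed.

Definition del_edges G D : sgraph T :=
  SGraph (del_rel_sym G D) (del_rel_irrefl G D).

Definition del_edge G e : sgraph T := del_edges G [set e].

Definition connected G : Prop := forall x y : T, connect G x y.

Definition edge_connected (k : nat) G : Prop :=
  1 < #|T| /\
  forall D, D \subset edges G -> #|D| < k -> connected (del_edges G D).

Definition component G (x : T) : {set T} := [set y | connect G x y].

(* p is an isomorphism from the path 0 - 1 - ... - (n - 1) onto the subgraph of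
   G induced by C. *)
Definition is_path G C (n : nat) : Prop :=
  exists p : 'I_n -> T,
    [/\ injective p, [set p i | i : 'I_n] = C
      & forall i j : 'I_n,
          G (p i) (p j) = (i.+1 == j :> nat) || (j.+1 == i :> nat)].

(* F has the same vertex type as G, hence F is a spanning subgraph as soon as
   its edges are edges of G. *)
Definition path_factor (k : nat) G F : Prop :=
  edges F \subset edges G /\
  forall x : T, exists2 n : nat, k <= n & is_path F (component F x) n.

Definition path_factor_covered (k : nat) G : Prop :=
  forall f, f \in edges G -> exists2 F, path_factor k G F & f \in edges F.

Definition path_factor_uniform (k : nat) G : Prop :=
  forall e, e \in edges G -> path_factor_covered k (del_edge G e).

Lemma edgesP G e :
  reflect (exists x y : T, G x y /\ e = [set x; y]) (e \in edges G).
Proof.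
apply: (iffP imsetP) => [[[x y] Gxy ->]|[x [y [Gxy ->]]]].
  by exists x, y; rewrite inE in Gxy.
by exists (x, y); rewrite ?inE.
Qed.

Lemma edges_del G D : edges (del_edges G D) = edges G :\: D.
Proof.
apply/setP => e; rewrite inE; apply/edgesP/andP.
  by case=> x [y [/andP [Gxy nD] ->]]; split=> //; apply/edgesP; exists x, y.
case=> nD /edgesP [x [y [Gxy def_e]]]; exists x, y; split=> //.
by apply/andP; split=> //; rewrite -def_e.
Qed.

Lemma edges_pair G (x y : T) : ([set x; y] \in edges G) = G x y.
Proof.
apply/edgesP/idP => [[a [b [Gab /setP E]]]|Gxy]; last by exists x, y.
have := E b; have := E a; have := E y; have := E x.
rewrite !inE !eqxx ?orbT /= => /esym/orP [] /eqP -> /esym/orP [] /eqP -> //.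
- by rewrite !orbb => _ /eqP ba; rewrite ba in Gab.
- by rewrite (adj_sym G).
- by rewrite !orbb => /eqP ab; rewrite ab in Gab.
Qed.

End Graphs.

(* Main.v *)
(* Put g = G - e and let f be an edge of g. Among all partitions of the vertex
   set into paths of g, one of which runs through f, take one of minimal cost:
   paths with 1 or 2 vertices are bad and cost 2 and 3 respectively, the others
   are free. Suppose that R is a bad path with last vertex r.
   - If r is adjacent to an inner vertex y of a path Q, then R can be attached
     at y to either side of Q, cutting off the other side (unless this destroys
     f), so both sides are short. As a result Q contains at most one neighbour
     of r, or at most two if Q runs through f.
   - Call Q hit if it contains a neighbour of r. The end a of a hit path Q
     cannot be adjacent to the end of another hit path Q': attach R to Q at y
     and the side of a to Q'. If the two ends of Q were adjacent, then Q would
     be a cycle, to which R could be attached at y. An end of Q is not adjacent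
     to an end of R, since R and Q could be joined.
   So the ends of the hit paths, with the first vertex of R, are independent
   in g. Removing one end of e makes them independent in G, and counting gives
   alpha(G) >= 2 delta(G) - 4, provided that r is not an end of e when R has
   two vertices. *)
Require Import Defs.
From mathcomp Require Import all_boot all_order all_algebra zify.
From Stdlib Require Import Classical_Prop.

Set Implicit Arguments.
Unset Strict Implicit.
Unset Printing Implicit Defensive.

(** * Exchange arguments in an optimal path partition *)

Section Moves.
Variables (T : eqType) (g h : rel T).
Hypotheses (g_sym : symmetric g) (h_sym : symmetric h).
Implicit Types (s Q R : seq T) (l : seq (seq T)).

Lemma sorted_catE (e : rel T) x0 s1 s2 :
  0 < size s1 -> 0 < size s2 ->
  sorted e (s1 ++ s2) = [&& sorted e s1, e (last x0 s1) (head x0 s2) & sorted e s2].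
Proof. by case: s1 s2 => [|x s1] [|y s2] //= _ _; rewrite cat_path. Qed.

Lemma sorted_revE (e : rel T) s : symmetric e -> sorted e (rev s) = sorted e s.
Proof. by move=> e_sym; rewrite rev_sorted; apply: eq_sorted => x y; rewrite e_sym. Qed.

Lemma sorted_split (e : rel T) x0 s t : 0 < t < size s ->
  sorted e s = [&& sorted e (take t s), e (nth x0 s t.-1) (nth x0 s t) & sorted e (drop t s)].
Proof.
move=> /andP[t0 ts]; rewrite -{1}(cat_take_drop t s) (sorted_catE e x0).
- by rewrite -!nth_last size_take ts nth_take ?prednK // -nth0 nth_drop addn0.
- by rewrite size_take ts.
- by rewrite size_drop subn_gt0.
Qed.

(* The values 2 and 3 make it profitable both to join two isolated vertices and
   to replace a bad path with two vertices by one with a single vertex. Empty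
   paths are allowed and cost nothing. *)
Definition weight n := nth 0 [:: 0; 2; 3] n.

Lemma weight_ge3 n : 2 < n -> weight n = 0.
Proof. by move=> n3; rewrite /weight nth_default. Qed.

Definition total_weight l := \sum_(s <- l) weight (size s).

(* [h x y] will say that [xy] is not the edge [f]. Then [sorted h s] says that
   the path [s] does not use [f], and the last premise that [f] is kept. *)
Definition optimal l := forall l',
  all (sorted g) l' -> perm_eq (flatten l') (flatten l) ->
  (all (sorted h) l' -> all (sorted h) l) -> total_weight l <= total_weight l'.

Lemma optimal_perm l1 l2 : perm_eq l1 l2 -> optimal l1 -> optimal l2.
Proof.
move=> p12 opt l' gl' pl' hl'.
rewrite /total_weight -(perm_big _ p12); apply: opt => //.
  by apply: perm_trans pl' _; rewrite perm_sym perm_flatten.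
by rewrite (perm_all _ p12).
Qed.

(** A cheaper rearrangement of [l1], completed by the untouched [l2], would be a cheaper one of the
    whole. So exchanges may be local. *)
Lemma optimal_catl l1 l2 : all (sorted g) l2 -> optimal (l1 ++ l2) -> optimal l1.
Proof.
move=> gl2 opt l' gl' pl' hl'.
have := opt (l' ++ l2); rewrite all_cat gl' gl2 !flatten_cat perm_cat2r pl'.
rewrite /total_weight !big_cat leq_add2r; apply=> //.
by rewrite !all_cat => /andP[/hl' -> ->].
Qed.

Lemma optimal_rev s l : optimal (s :: l) -> optimal (rev s :: l).
Proof.
move=> opt l' gl' pl' hl'; have := opt l' gl'.
rewrite /total_weight !big_cons size_rev; apply.
  by apply: perm_trans pl' _; rewrite /= perm_cat2r perm_rev.
by move=> /hl' /=; rewrite sorted_revE.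
Qed.

(** * Exchanges between a bad path and one or two other paths *)

Section Hits.
Variables (x0 : T) (R Q : seq T).
Hypotheses (R0 : 0 < size R) (R2 : size R <= 2) (gR : sorted g R).
Let r := last x0 R.

(* For [t = 0] this joins [R] and [Q] at an end. *)
Lemma optimal_split t : optimal [:: R; Q] -> sorted g Q -> t < size Q ->
  g r (nth x0 Q t) -> (0 < t -> h (nth x0 Q t.-1) (nth x0 Q t)) ->
  weight (size R) + weight (size Q) <= weight (size R + (size Q - t)) + weight t.
Proof.
move=> opt gQ tQ grt htQ.
have dQ : 0 < size (drop t Q) by rewrite size_drop subn_gt0.
have hdQ : head x0 (drop t Q) = nth x0 Q t by rewrite -nth0 nth_drop addn0.
have := opt [:: R ++ drop t Q; take t Q].
rewrite /total_weight !big_cons !big_nil !addn0 size_cat size_drop size_take tQ.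
apply.
- by rewrite /= (take_sorted _ gQ) (sorted_catE g x0) // gR hdQ grt drop_sorted.
- by rewrite /= !cats0 -catA perm_cat2l -{3}(cat_take_drop t Q) perm_catC.
- rewrite /= (sorted_catE h x0) // => /and3P[/and3P[-> _ hd] ht _].
  have [t0|t0] := posnP t; first by move: hd; rewrite t0 drop0 => ->.
  by rewrite (@sorted_split h x0 Q t) ?t0 // ht htQ // hd.
Qed.

(** Otherwise the single vertex of [R] could be inserted between its two neighbours, giving a free
    path and saving at least the weight of [R]. *)
Lemma optimal_insert t : optimal [:: R; Q] -> sorted g Q -> size R = 1 ->
  t.+1 < size Q -> g r (nth x0 Q t) -> g r (nth x0 Q t.+1) ->
  ~~ h (nth x0 Q t) (nth x0 Q t.+1).
Proof.
move=> opt gQ; rewrite /r; case: R opt => [|a [|b l]] //= opt _ tQ gt gt'.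
apply/negP => ht.
have tk : 0 < size (take t.+1 Q) by rewrite size_take tQ.
have lt : last x0 (take t.+1 Q) = nth x0 Q t.
  by rewrite -nth_last size_take tQ nth_take.
have hd : head x0 (drop t.+1 Q) = nth x0 Q t.+1 by rewrite -nth0 nth_drop addn0.
have dk : 0 < size (drop t.+1 Q) by rewrite size_drop subn_gt0.
have tE (e : rel T) := @sorted_split e x0 Q t.+1 tQ.
suff : total_weight [:: [:: a]; Q] <= total_weight [:: take t.+1 Q ++ a :: drop t.+1 Q].
  rewrite /total_weight !big_cons !big_nil size_cat /= size_drop size_take tQ.
  by rewrite addnS subnKC ?(ltnW tQ) //; case: (size Q) tQ => [|[|[|n]]].
move: (gQ); rewrite tE => /and3P[g1 _ g2].
have ins (e : rel T) : sorted e (take t.+1 Q ++ a :: drop t.+1 Q) =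
    [&& sorted e (take t.+1 Q), e (nth x0 Q t) a, e a (nth x0 Q t.+1) & sorted e (drop t.+1 Q)].
  by rewrite (sorted_catE e x0) // lt /= -hd; case: (drop _ _) dk.
apply: opt; rewrite /= ?ins ?cats0 ?andbT.
- by rewrite g1 g_sym gt gt' g2.
- by rewrite perm_catC /= perm_cons -{3}(cat_take_drop t.+1 Q) perm_catC.
- by case/and4P => h1 _ _ h2; rewrite tE h1 h2 ht.
Qed.

(** Otherwise the cycle could be opened before position [t] and attached to [R], giving one free
    path. The only edge lost is the one entering position [t], which is not [f]. *)
Lemma optimal_cycle t : optimal [:: R; Q] -> sorted g Q -> 2 < size Q ->
  0 < t < (size Q).-1 -> g r (nth x0 Q t) ->
  h (nth x0 Q t.-1) (nth x0 Q t) ->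
  ~~ g (head x0 Q) (last x0 Q).
Proof.
move=> opt gQ Q3 /andP[t0 tQ] gt ht; apply/negP => gc.
have tQ' : t < size Q by lia.
have dQ : 0 < size (drop t Q) by rewrite size_drop subn_gt0.
have tk : 0 < size (take t Q) by rewrite size_take tQ'.
have hdQ : head x0 (drop t Q) = nth x0 Q t by rewrite -nth0 nth_drop addn0.
have tE (e : rel T) := @sorted_split e x0 Q t.
have ct : 0 < size (drop t Q ++ take t Q) by rewrite size_cat addn_gt0 dQ.
have hct : head x0 (drop t Q ++ take t Q) = nth x0 Q t.
  by rewrite -hdQ; case: (drop _ _) dQ.
have ld : last x0 (drop t Q) = last x0 Q.
  by rewrite -[in RHS](cat_take_drop t Q) last_cat; case: (drop _ _) dQ.
have ht' : head x0 (take t Q) = head x0 Q by rewrite -!nth0 nth_take.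
have cE (e : rel T) : sorted e (R ++ drop t Q ++ take t Q) =
    [&& sorted e R, e r (nth x0 Q t), sorted e (drop t Q),
        e (last x0 Q) (head x0 Q) & sorted e (take t Q)].
  by rewrite (sorted_catE e x0) // (sorted_catE e x0 dQ) // hct ld ht'.
suff : total_weight [:: R; Q] <= total_weight [:: R ++ drop t Q ++ take t Q].
  rewrite /total_weight !big_cons !big_nil !size_cat size_drop size_take tQ'.
  rewrite subnK ?(ltnW tQ') //.
  rewrite (weight_ge3 Q3) (@weight_ge3 (_ + _)) ?ltn_addl //.
  by case: (size R) R0 R2 => [|[|[|]]].
move: (gQ); rewrite tE ?t0 // => /and3P[g1 _ g2].
apply: opt; rewrite /= ?cE ?cats0 ?andbT.
- by rewrite g1 g2 gR gt g_sym gc.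
- by rewrite perm_cat2l -{3}(cat_take_drop t Q) perm_catC.
- by case/and5P => -> _ h1 _ h2; rewrite tE ?t0 // h1 h2 ht.
Qed.

(** [R] takes the part of [Q] from position [t] on, which has at least two vertices, and the rest
    goes to [Q']; both new paths are free. As [Q] avoids [f], cutting it cannot lose [f]. *)
Lemma optimal_join t Q' : optimal [:: R; Q; Q'] -> sorted g Q -> sorted g Q' ->
  2 < size Q -> 2 < size Q' -> 0 < t < (size Q).-1 -> g r (nth x0 Q t) ->
  sorted h Q -> ~~ g (last x0 Q') (head x0 Q).
Proof.
move=> opt gQ gQ' Q3 Q'3 /andP[t0 tQ] gt hQ; apply/negP => gc.
have tQ' : t < size Q by lia.
have dQ : 0 < size (drop t Q) by rewrite size_drop subn_gt0.
have tk : 0 < size (take t Q) by rewrite size_take tQ'.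
have hdQ : head x0 (drop t Q) = nth x0 Q t by rewrite -nth0 nth_drop addn0.
have ht' : head x0 (take t Q) = head x0 Q by rewrite -!nth0 nth_take.
have Q'0 : 0 < size Q' by lia.
have cE (e : rel T) : sorted e (R ++ drop t Q) =
    [&& sorted e R, e r (nth x0 Q t) & sorted e (drop t Q)].
  by rewrite (sorted_catE e x0) // hdQ.
have cE' (e : rel T) : sorted e (Q' ++ take t Q) =
    [&& sorted e Q', e (last x0 Q') (head x0 Q) & sorted e (take t Q)].
  by rewrite (sorted_catE e x0) // ht'.
suff : total_weight [:: R; Q; Q'] <= total_weight [:: R ++ drop t Q; Q' ++ take t Q].
  rewrite /total_weight !big_cons !big_nil !size_cat size_drop size_take tQ'.
  rewrite !(@weight_ge3 (_ + _)); [|lia..].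
  by case: (size R) R0 R2 => [|[|[|]]].
apply: opt; rewrite /= ?cE ?cE' ?cats0 ?andbT.
- by rewrite gR gt gQ' gc drop_sorted ?take_sorted.
- by apply/permP => p; rewrite -{3}(cat_take_drop t Q) !count_cat; lia.
- by case/andP => /and3P[-> _ _] /and3P[-> _ _]; rewrite hQ.
Qed.
End Hits.

Lemma head_rev x0 s : head x0 (rev s) = last x0 s.
Proof. by case/lastP: s => // s x; rewrite rev_rcons last_rcons. Qed.

Lemma last_rev x0 s : last x0 (rev s) = head x0 s.
Proof. by rewrite -head_rev revK. Qed.

Lemma count_nth (a : pred T) x0 k s : k <= count a s ->
  exists I,
    [/\ size I = k, sorted ltn I & forall i, i \in I -> i < size s /\ a (nth x0 s i)].
Proof.
move=> ks; pose J := [seq i <- iota 0 (size s) | a (nth x0 s i)].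
have sJ : size J = count a s by rewrite size_filter -[in RHS](mkseq_nth x0 s) count_map.
exists (take k J); split; first by rewrite size_takel // sJ.
  by rewrite take_sorted // sorted_filter ?iota_ltn_sorted //; apply: ltn_trans.
by move=> i /mem_take; rewrite mem_filter mem_iota => /andP[].
Qed.

(** * Neighbours of the last vertex of a bad path *)

Section BadPath.
Variables (x0 : T) (R : seq T).
Hypotheses (R0 : 0 < size R) (R2 : size R <= 2) (gR : sorted g R).
Let r := last x0 R.

Lemma optimal_swap_rev Q l : optimal (R :: Q :: l) -> optimal (R :: rev Q :: l).
Proof.
have sw s s' : perm_eq [:: s, s' & l] [:: s', s & l].
  by apply/permP => p /=; rewrite addnCA.
by move=> opt; apply: (optimal_perm (sw _ _)); apply: optimal_rev; apply: optimal_perm opt.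
Qed.

(** The mirror image of [optimal_split]: [R] takes the vertices up to position [t]. *)
Lemma optimal_split_rev Q t : optimal [:: R; Q] -> sorted g Q -> t < size Q ->
  g r (nth x0 Q t) -> (t.+1 < size Q -> h (nth x0 Q t) (nth x0 Q t.+1)) ->
  weight (size R) + weight (size Q) <=
    weight (size R + t.+1) + weight (size Q - t.+1).
Proof.
move=> opt gQ tQ gt ht.
pose k := size Q - t.+1.
have kQ : k < size Q by rewrite /k; lia.
have kE : size Q - k.+1 = t by rewrite /k; lia.
have kE' : size Q - k = t.+1 by rewrite /k; lia.
rewrite -/k -kE'.
have := @optimal_split x0 R (rev Q) R0 gR k; rewrite size_rev; apply=> //.
- exact: optimal_swap_rev.
- by rewrite sorted_revE.
- by rewrite nth_rev // kE.
move=> k0; rewrite !nth_rev ?kE ?prednK ?kE' //; last by lia.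
by rewrite h_sym; apply: ht; rewrite /k in k0; lia.
Qed.

(** A hit at an end would let [R] and [Q] be joined, and the joined path costs less than the two
    together. *)
Lemma hit_inner Q t : optimal [:: R; Q] -> sorted g Q -> t < size Q ->
  g r (nth x0 Q t) -> 0 < t < (size Q).-1.
Proof.
move=> opt gQ tQ gt; apply/andP; split.
  have [t0|//] := posnP t; subst t.
  have := optimal_split R0 gR opt gQ tQ gt; move=> /(_ (fun=> ltac:(by [])));
    rewrite subn0.
  case: (size R) R0 R2 => [|[|[|]]] //; by case: (size Q) tQ => [|[|[|]]].
rewrite ltnNge; apply/negP => tQ'.
have := optimal_split_rev opt gQ tQ gt.
have -> : size Q = t.+1 by lia.
rewrite ltnn subnn => /(_ (fun=> ltac:(by []))).
by case: (size R) R0 R2 => [|[|[|]]] //; case: t {tQ gt tQ'} => [|[|]].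
Qed.

Lemma hit_size Q : optimal [:: R; Q] -> sorted g Q -> has (g r) Q -> 2 < size Q.
Proof.
move=> opt gQ /(has_nthP x0)[t tQ gt].
by have := hit_inner opt gQ tQ gt; lia.
Qed.

(** Abstracts the fact that a path without repeated vertices runs through [f] at most once. *)
Definition single_edge Q := forall i j, i.+1 < size Q -> j.+1 < size Q ->
  ~~ h (nth x0 Q i) (nth x0 Q i.+1) -> ~~ h (nth x0 Q j) (nth x0 Q j.+1) -> i = j.

(** The paths with [n] and with [k + (n - t)] vertices are free, so the [t] vertices left over must
    cost at least as much as the bad path with [k] vertices. *)
Lemma weight_split k n t : 0 < k <= 2 -> 0 < t < n.-1 ->
  weight k + weight n <= weight (k + (n - t)) + weight t -> t <= 2 /\ (k = 2 -> t = 2).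
Proof.
move=> k12 tn; rewrite (@weight_ge3 n) ?(@weight_ge3 (_ + _)); [|lia..].
have [t3|t3] := ltnP 2 t.
  by rewrite (weight_ge3 t3); case: k k12 => [|[|[|]]].
by case: k k12 => [|[|[|]]] //; case: t tn t3 => [|[|[|]]].
Qed.

(** Cutting next to a hit, at an edge other than [f], leaves at most two vertices over, and exactly
    two if [R] has two. If [R] is a single vertex, consecutive hits allow an insertion. Too many
    hits violate these constraints. *)
Lemma count_hits Q : optimal [:: R; Q] -> sorted g Q -> single_edge Q ->
  count (g r) Q <= 1 + ~~ sorted h Q.
Proof.
move=> opt gQ sQ.
pose hit t := t < size Q /\ g r (nth x0 Q t).
pose F t := ~~ h (nth x0 Q t) (nth x0 Q t.+1).
have inner t : hit t -> 0 < t < (size Q).-1 by case=> tQ gt; apply: hit_inner.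
have left_hit t : hit t -> ~~ F t.-1 -> t <= 2 /\ (size R = 2 -> t = 2).
  move=> ht nF; have t0 := inner _ ht; case: ht => tQ gt.
  apply: (@weight_split _ (size Q)); rewrite ?R0 //.
  by apply: (optimal_split (x0 := x0)) => // t1; move: nF; rewrite /F prednK ?t1 // negbK.
have right_hit t : hit t -> ~~ F t ->
    size Q - t.+1 <= 2 /\ (size R = 2 -> size Q - t.+1 = 2).
  move=> ht nF; have t0 := inner _ ht; case: ht => tQ gt.
  apply: (@weight_split _ (size Q)); rewrite ?R0 //; first by lia.
  rewrite subKn //; apply: optimal_split_rev => // t1.
  by move: nF; rewrite negbK.
have insert t : hit t -> hit t.+1 -> size R = 1 -> F t.
  by move=> [tQ gt] [tQ' gt'] R1; apply: (optimal_insert (x0 := x0) opt).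
have uF i j : i.+1 < size Q -> j.+1 < size Q -> F i -> F j -> i = j by apply: sQ.
have R12 : size R = 1 \/ size R = 2 by lia.
rewrite leqNgt; apply/negP.
have [hQ|nhQ] := boolP (sorted h Q); rewrite /= ?addn0 ?addn1 => /(count_nth x0)[].
  move=> [|i [|j [|? ?]]] [] //= _ /andP[ij _] hit2.
  have /inner i1 : hit i by apply: hit2; rewrite inE eqxx.
  have /inner j1 : hit j by apply: hit2; rewrite !inE eqxx orbT.
  have hi : hit i by apply: hit2; rewrite inE eqxx.
  have hj : hit j by apply: hit2; rewrite !inE eqxx orbT.
  have nF k : k.+1 < size Q -> ~~ F k by move=> kQ; rewrite negbK; apply: (sortedP x0 hQ).
  (* The bounds force [i = 1] and [j = 2]. If [R] has two vertices, [i] would have to be 2; if it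
     has one, it can be inserted between the hits. *)
  have [] := left_hit _ hj (nF j.-1 ltac:(lia)); have [] := right_hit _ hi (nF i ltac:(lia)).
  have [] := left_hit _ hi (nF i.-1 ltac:(lia)).
  move=> a1 a2 a3 a4 a5 a6; case: R12 => [R1|R22]; last by lia.
  by have := nF i ltac:(lia); rewrite insert //; have <- : j = i.+1 by lia.
move=> [|i [|j [|k [|? ?]]]] [] //= _ /and3P[ij jk _] hit3.
have hi : hit i by apply: hit3; rewrite !inE eqxx.
have hj : hit j by apply: hit3; rewrite !inE eqxx orbT.
have hk : hit k by apply: hit3; rewrite !inE eqxx !orbT.
have [i1 j1 k1] := And3 (inner _ hi) (inner _ hj) (inner _ hk).
have nF2 a b : a < b -> b.+1 < size Q -> F a -> F b -> False.
  by move=> ab bQ Fa Fb; have := uF a b ltac:(lia) bQ Fa Fb; lia.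
(* If [f] comes right after [j], the edges entering [i] and [j] are not [f], and the argument for
   two hits applies to them. *)
have [Fj|nFj] := boolP (F j).
  have nFj' : ~~ F j.-1 by apply/negP => Fj'; apply: (nF2 _ _ _ _ Fj' Fj); lia.
  have [j2 _] := left_hit _ hj nFj'.
  have nFi : ~~ F i.-1 by apply/negP => Fi; apply: (nF2 _ _ _ _ Fi Fj); lia.
  have [_ i2] := left_hit _ hi nFi.
  case: R12 => [R1|R22]; last by lia.
  have ij1 : j = i.+1 by lia.
  by move: nFj'; rewrite ij1 /= insert // -ij1.
(* Otherwise at most two vertices follow [j]; since [k] is not the last vertex, it comes right after
   [j]. *)
have [j2 j3] := right_hit _ hj nFj.
have kj : k = j.+1 by lia.
case: R12 => [R1|R22].
  by move: nFj; rewrite insert // -kj.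
(* Only one vertex follows [k], too few for a cut there unless that edge is [f]. But then cuts
   before [i] and before [j] put both at position 2. *)
have Fk : F k by apply: contraT => /(right_hit _ hk)[_ /(_ R22)]; lia.
have nFj' : ~~ F j.-1 by apply/negP => Fj'; apply: (nF2 _ _ _ _ Fj' Fk); lia.
have nFi : ~~ F i.-1 by apply/negP => Fi; apply: (nF2 _ _ _ _ Fi Fk); lia.
have [] := left_hit _ hj nFj'; have [] := left_hit _ hi nFi; lia.
Qed.

(** [f] is not on both sides of the hit, so the cycle can be opened before or after it; the latter
    is the former for [rev Q]. *)
Lemma hit_not_cycle Q : optimal [:: R; Q] -> sorted g Q -> single_edge Q ->
  has (g r) Q -> ~~ g (head x0 Q) (last x0 Q).
Proof.
move=> opt gQ sQ /(has_nthP x0)[t tQ gt].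
have t1 := hit_inner opt gQ tQ gt.
have [ht|nht] := boolP (h (nth x0 Q t.-1) (nth x0 Q t)).
  by apply: (@optimal_cycle x0 R Q _ _ _ t) => //; lia.
have ht : h (nth x0 Q t) (nth x0 Q t.+1).
  apply: contraT => nht'.
  by have := sQ t.-1 t; rewrite prednK => [/(_ _ _ nht nht')|]; lia.
rewrite g_sym -(head_rev x0 Q) -(last_rev x0 Q).
pose k := size Q - t.+1.
have kE : size Q - k.+1 = t by rewrite /k; lia.
have kE' : size Q - k.-1.+1 = t.+1 by rewrite /k; lia.
have k1 : 0 < k < (size Q).-1 by rewrite /k; lia.
apply: (@optimal_cycle x0 R (rev Q) _ _ _ k) => //.
- exact: optimal_swap_rev.
- by rewrite sorted_revE.
- by rewrite size_rev; lia.
- by rewrite size_rev.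
- by rewrite nth_rev ?kE //; lia.
- by rewrite !nth_rev ?kE ?kE' 1?h_sym //; lia.
Qed.

Lemma hit_not_end Q x : optimal [:: R; Q] -> sorted g Q ->
  x \in [:: head x0 Q; last x0 Q] -> 0 < size Q -> ~~ g r x.
Proof.
move=> opt gQ; rewrite !inE => /orP[]/eqP-> Q0; apply/negP => gx.
  by have := @hit_inner Q 0 opt gQ Q0; rewrite nth0 gx => /(_ isT).
by have := @hit_inner Q (size Q).-1 opt gQ; rewrite nth_last gx prednK // => /(_ _ isT); lia.
Qed.

(** Reversing [Q] or [Q'] reduces the four choices of ends to [optimal_join]. *)
Lemma hit_not_join Q Q' x y : optimal [:: R; Q; Q'] -> sorted g Q -> sorted g Q' ->
  2 < size Q' -> has (g r) Q -> sorted h Q ->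
  x \in [:: head x0 Q; last x0 Q] -> y \in [:: head x0 Q'; last x0 Q'] -> ~~ g x y.
Proof.
wlog xE : Q x / x = head x0 Q => [wl opt gQ gQ' Q'3 hQ nQ xQ yQ|].
  move: (xQ); rewrite !inE => /orP[]/eqP xE; first by apply: (wl Q).
  apply: (wl (rev Q)); rewrite ?sorted_revE ?head_rev ?has_rev ?last_rev //.
    exact: optimal_swap_rev.
  by move: xQ; rewrite !inE orbC.
wlog yE : Q' y / y = last x0 Q' => [wl opt gQ gQ' Q'3 hQ nQ xQ yQ|].
  move: (yQ); rewrite !inE => /orP[]/eqP yE; last by apply: (wl Q').
  apply: (wl (rev Q')); rewrite ?sorted_revE ?head_rev ?size_rev ?last_rev //.
    have sw s s' : perm_eq [:: R; s; s'] [:: s'; R; s].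
      by apply/permP => p /=; rewrite !addn0 addnA addnC.
    by have := optimal_rev (optimal_perm (sw _ _) opt); apply: optimal_perm; rewrite perm_sym.
  by move: yQ; rewrite !inE orbC.
move=> opt gQ gQ' Q'3 /(has_nthP x0)[t tQ gt] nQ _ _; rewrite xE yE g_sym.
have opt2 : optimal [:: R; Q] by apply: (@optimal_catl [:: R; Q] [:: Q']) => //=; rewrite gQ'.
have t1 := hit_inner opt2 gQ tQ gt.
by apply: (@optimal_join x0 R Q _ _ _ t) => //; lia.
Qed.

End BadPath.
End Moves.

(** * Path partitions of a graph *)

Section Partition.
Variables (T : finType) (G : sgraph T).
Implicit Types (f : {set T}) (Q R : seq T) (l : seq (seq T)).

Definition avoids f : rel T := fun x y => [set x; y] != f.

Lemma avoids_sym f : symmetric (avoids f).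
Proof. by move=> x y; rewrite /avoids setUC. Qed.

Lemma not_avoidsP x0 f Q :
  reflect (exists2 i, i.+1 < size Q & [set nth x0 Q i; nth x0 Q i.+1] = f)
    (~~ sorted (avoids f) Q).
Proof.
apply: (iffP idP) => [nQ|[i iQ fi]]; last first.
  by apply/negP => /(sortedP x0)/(_ _ iQ); rewrite /avoids fi eqxx.
have /existsP[i /andP[iQ /eqP fi]] :
    [exists i : 'I_(size Q), (i.+1 < size Q) && ([set nth x0 Q i; nth x0 Q i.+1] == f)].
  apply: contraNT nQ => /existsPn nQ; apply/(sortedP x0) => i iQ.
  by have := nQ (Ordinal (ltnW iQ)); rewrite /= iQ.
by exists i.
Qed.

Lemma not_avoids_mem f Q x : ~~ sorted (avoids f) Q -> x \in f -> x \in Q.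
Proof.
move=> /(not_avoidsP x)[i iQ <-] /set2P[]->; apply: mem_nth => //.
exact: ltnW.
Qed.

(** * Optimal partitions through a fixed edge and their independent sets *)

Section FixedEdge.
Variable f : {set T}.
Hypothesis fG : f \in edges G.
Let nf := avoids f.
Let nf_sym := avoids_sym f.

Definition path_partition l : bool :=
  [&& all (sorted G) l, perm_eq (flatten l) (enum T) & ~~ all (sorted nf) l].

Lemma uniq_single_edge x0 Q : uniq Q -> single_edge nf x0 Q.
Proof.
move=> uQ i j iQ jQ; rewrite !negbK => /eqP <- /eqP/setP E.
have Eij k : k < size Q -> (k \in [:: i; i.+1]) = (k \in [:: j; j.+1]).
  by move=> kQ; move: (E (nth x0 Q k)); rewrite !inE !nth_uniq //; lia.
have := Eij _ iQ; have := Eij _ (ltnW iQ); rewrite !inE !eqxx orbT.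
by move=> /esym/orP[]/eqP ? /esym/orP[]/eqP ?; lia.
Qed.

(** Every path through [f] contains the end [u] of [f], which occurs at most once. *)
Lemma count_unsorted l : uniq (flatten l) -> count (fun Q => ~~ sorted nf Q) l <= 1.
Proof.
have /edgesP[u [v [_ fE]]] := fG => ul.
have uf : u \in f by rewrite fE !inE eqxx.
apply: (@leq_trans (count_mem u (flatten l))); last by rewrite count_uniq_mem // leq_b1.
elim: l {ul} => //= Q l IH; rewrite count_cat leq_add //.
by case: (boolP (sorted nf Q)) => //= /not_avoids_mem/(_ uf); rewrite -has_pred1 has_count.
Qed.

Lemma subseq_ends x0 Q : 1 < size Q -> subseq [:: head x0 Q; last x0 Q] Q.
Proof. case: Q => [|x [|y Q]] // _.
by apply: (@cat_subseq _ [:: x] [:: last y Q] [:: x] (y :: Q)); rewrite // sub1seq mem_last. Qed.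

Lemma subseq_flatten_map (F : seq T -> seq T) l :
  (forall Q, Q \in l -> subseq (F Q) Q) -> subseq (flatten (map F l)) (flatten l).
Proof.
elim: l => //= Q l IH lF; apply: cat_subseq; first by apply: lF; rewrite inE eqxx.
by apply: IH => Q' lQ'; apply: lF; rewrite inE lQ' orbT.
Qed.

Lemma flatten_filter_subseq (a : pred (seq T)) l : subseq (flatten (filter a l)) (flatten l).
Proof.
elim: l => //= Q l IH; case: (a Q) => /=; first by rewrite cat_subseq.
exact: subseq_trans IH (suffix_subseq _ _).
Qed.

(** Let [H] be the list of hit paths. The degree is at most [size R + size H], while [A], made of
    the first vertex of [R] and both ends of each path in [H], has [2 * size H + 1] vertices. *)
Lemma optimal_independent x0 R l : optimal G nf (R :: l) -> path_partition (R :: l) ->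
  0 < size R <= 2 ->
  exists2 A, independent G A & (degree G (last x0 R)).*2 < #|A| + (size R).*2.
Proof.
set r := last x0 R => opt /and3P[/= /andP[gR gl] pl _] /andP[R0 R2].
have Gs := adj_sym G.
have ul : uniq (R ++ flatten l) by rewrite (perm_uniq pl) enum_uniq.
have ulf : uniq (flatten l) by move: ul; rewrite cat_uniq => /and3P[].
have glQ Q : Q \in l -> sorted G Q by move/(allP gl).
have opt1 Q : Q \in l -> optimal G nf [:: R; Q].
  move=> lQ; apply: (@optimal_catl _ _ _ _ (rem Q l)) => /=.
    by apply/allP => Q' /mem_rem/glQ.
  by apply: optimal_perm opt; rewrite perm_cons perm_to_rem.
have uQ Q : Q \in l -> single_edge nf x0 Q.
  move=> lQ; apply: uniq_single_edge; move: ulf.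
  by rewrite (perm_uniq (perm_flatten (perm_to_rem lQ))) /= cat_uniq => /and3P[].
pose H := [seq Q <- l | has (G r) Q].
have HP Q : Q \in H -> has (G r) Q /\ Q \in l by rewrite mem_filter => /andP.
have H3 Q : Q \in H -> 2 < size Q.
  by move=> /HP[hQ lQ]; apply: (hit_size Gs nf_sym R0 R2 gR (opt1 _ lQ) (glQ _ lQ) hQ).
(* The last [1] is for the path through [f], which may be hit twice. *)
have deg : degree G r <= (size R).-1 + size H + 1.
  have -> : degree G r = count (G r) (R ++ flatten l).
    rewrite (permP pl) /degree -sum1_card -sum1_count big_enum_cond.
    by apply: eq_bigl => x; rewrite !inE.
  rewrite count_cat -addnA leq_add //.
    have : has (predC (G r)) R.
      apply/hasP; exists r; last by rewrite /= (adj_irrefl G).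
      by rewrite /r; case: (R) R0 => //= x s _; apply: mem_last.
    by rewrite has_count -(count_predC (G r) R); lia.
  apply: leq_trans (leq_add (leqnn _) (count_unsorted ulf)).
  rewrite size_filter; elim: (l) opt1 glQ uQ => //= Q l' IH o1 o2 o3.
  rewrite count_cat addnACA leq_add //.
    have lQ : Q \in Q :: l' by rewrite inE eqxx.
    have := count_hits Gs nf_sym R0 R2 gR (o1 _ lQ) (o2 _ lQ) (o3 _ lQ).
    by rewrite has_count; case: (count (G r) Q).
  by apply: IH => Q' lQ'; [apply: o1 | apply: o2 | apply: o3]; rewrite inE lQ' orbT.
pose ends Q := [:: head x0 Q; last x0 Q].
pose L := head x0 R :: flatten (map ends H).
(* Hit paths have at least three vertices, so their two ends are at distinct positions and [L] is a
   subsequence of [R ++ flatten l]. *)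
have uL : uniq L.
  apply: subseq_uniq ul; rewrite -[L]/([:: head x0 R] ++ _); apply: cat_subseq.
    by case: (R) R0 => //= x s _; rewrite eqxx sub0seq.
  apply: subseq_trans (flatten_filter_subseq (has (G r)) l).
  by apply: subseq_flatten_map => Q /H3 Q3; apply: subseq_ends; apply: ltnW.
exists [set x in L]; last first.
  rewrite cardsE (card_uniqP uL) /= size_flatten /shape -map_comp.
  have -> : sumn (map (size \o ends) H) = (size H).*2.
    by elim: (H) => //= Q H' ->; rewrite doubleS.
  by move: deg; lia.
have LP x : x \in L -> x = head x0 R \/ exists2 Q, Q \in H & x \in ends Q.
  rewrite inE => /orP[/eqP->|/flatten_mapP[Q HQ xQ]]; [by left|by right; exists Q].
(* Reversing [R] makes its first vertex the last one, to which [hit_not_end] applies. *)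
have RQ Q x : Q \in H -> x \in ends Q -> ~~ G (head x0 R) x.
  move=> HQ xQ; have [_ lQ] := HP _ HQ; rewrite -last_rev.
  apply: (@hit_not_end _ _ nf Gs nf_sym x0 (rev R) _ _ _ Q) => //.
  - by rewrite size_rev.
  - by rewrite size_rev.
  - by rewrite sorted_revE.
  - by apply: optimal_rev; auto.
  - by auto.
  - exact: ltnW (ltnW (H3 _ HQ)).
apply/forall_inP => x; rewrite inE => xL; apply/forall_inP => y; rewrite inE => yL.
have [->|[Q HQ xQ]] := LP _ xL; have [->|[Q' HQ' yQ']] := LP _ yL.
- by rewrite (adj_irrefl G).
- exact: RQ yQ'.
- by rewrite Gs; apply: RQ xQ.
have [hQ lQ] := HP _ HQ; have [hQ' lQ'] := HP _ HQ'.
have [QQ'|QQ'] := eqVneq Q Q'.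
  subst Q'; have := hit_not_cycle Gs nf_sym R0 R2 gR (opt1 _ lQ) (glQ _ lQ) (uQ _ lQ) hQ.
  move: xQ yQ'; rewrite !inE => /orP[]/eqP-> /orP[]/eqP-> //; rewrite ?(adj_irrefl G) //.
  by rewrite Gs.
have lQQ : perm_eq l [:: Q, Q' & rem Q' (rem Q l)].
  apply: perm_trans (perm_to_rem lQ) _; rewrite perm_cons; apply: perm_to_rem.
  have := lQ'; rewrite (perm_mem (perm_to_rem lQ)) inE => /orP[/eqP E|//].
  by rewrite E eqxx in QQ'.
have opt2 : optimal G nf [:: R; Q; Q'].
  apply: (@optimal_catl _ _ _ _ (rem Q' (rem Q l))) => /=.
    by apply/allP => Q'' /mem_rem/mem_rem/glQ.
  by apply: optimal_perm opt; rewrite perm_cons.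
have opt2' : optimal G nf [:: R; Q'; Q].
  apply: optimal_perm opt2; rewrite perm_cons; by apply/permP => p /=; rewrite addnCA.
(* At most one of [Q] and [Q'] runs through [f]; one that does not is cut. *)
have := count_unsorted ulf; rewrite (permP lQQ) /=.
have [sQ _|nsQ] := boolP (sorted nf Q).
  exact: (hit_not_join Gs nf_sym R0 R2 gR opt2 (glQ _ lQ) (glQ _ lQ') (H3 _ HQ') hQ sQ xQ yQ').
have [sQ' _|nsQ'] := boolP (sorted nf Q') => //.
rewrite Gs.
exact: (hit_not_join Gs nf_sym R0 R2 gR opt2' (glQ _ lQ') (glQ _ lQ) (H3 _ HQ) hQ' sQ' yQ' xQ).
Qed.

Lemma exists_path_partition : exists l, path_partition l.
Proof.
have /edgesP[u [v [Guv fE]]] := fG.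
exists ([:: u; v] :: [seq [:: x] | x <- enum T & x \notin f]); apply/and3P; split.
- by rewrite /= Guv; apply/allP => Q /mapP[x _ ->].
- rewrite -cat1s flatten_cat flatten_seq1 [flatten [:: _]]/=.
  apply: uniq_perm; rewrite ?enum_uniq //.
    rewrite cat_uniq filter_uniq ?enum_uniq // andbT /= inE andbT.
    apply/andP; split; first by apply/eqP => uv; rewrite uv (adj_irrefl G) in Guv.
    by apply/hasPn => x; rewrite mem_filter fE !inE => /andP[].
  by move=> x; rewrite mem_cat mem_filter !mem_enum fE !inE andbT orbN.
- by rewrite /= /nf /avoids fE eqxx.
Qed.

(** Descent on the weight: a rearrangement refuting optimality still uses [f], so it is again a path
    partition. *)
Lemma exists_optimal : exists2 l, path_partition l & optimal G nf l.
Proof.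
have [l] := exists_path_partition.
have [n] := ubnP (total_weight l); elim: n l => // n IH l ln pl.
have [[l' pl' ll']|nl] :=
    classic (exists2 l', path_partition l' & total_weight l' < total_weight l).
  by apply: (IH l') => //; apply: leq_trans ll' _.
exists l => // l' gl' pl' hl'; rewrite leqNgt; apply/negP => ll'.
case/and3P: pl => _ pl fl; case: nl; exists l' => //.
by rewrite /path_partition gl' (perm_trans pl' pl) (contra hl').
Qed.
End FixedEdge.

Lemma uniq_flatten_inj l Q Q' x : uniq (flatten l) -> Q \in l -> Q' \in l ->
  x \in Q -> x \in Q' -> Q = Q'.
Proof.
move=> ul lQ lQ' xQ xQ'; apply/eqP; apply: contraTT ul => QQ'.
rewrite (perm_uniq (perm_flatten (perm_to_rem lQ))) /= cat_uniq.
have rQ' : Q' \in rem Q l.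
  by move: lQ'; rewrite (perm_mem (perm_to_rem lQ)) inE eq_sym (negbTE QQ').
have -> : has (in_mem^~ (mem Q)) (flatten (rem Q l)).
  by apply/hasP; exists x => //; apply/flattenP; exists Q'.
by rewrite andbF.
Qed.

(** * The path factor given by a path partition *)

Section PathGraph.
Variable l : seq (seq T).
Hypothesis gl : all (sorted G) l.

(** With [[set x; y]] as the edge to avoid, this says that [x] and [y] are consecutive on some path
    of [l]. *)
Definition path_rel : rel T := fun x y => ~~ all (sorted (avoids [set x; y])) l.

Lemma path_rel_sym : symmetric path_rel.
Proof. by move=> x y; rewrite /path_rel setUC. Qed.

Lemma path_relP x y :
  reflect (exists2 Q, Q \in l & ~~ sorted (avoids [set x; y]) Q) (path_rel x y).
Proof. by rewrite /path_rel -has_predC; apply: hasP. Qed.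

Lemma path_rel_edges x y : path_rel x y -> [set x; y] \in edges G.
Proof.
move=> /path_relP[Q lQ /(not_avoidsP x)[i iQ <-]]; rewrite edges_pair.
exact: (sortedP x (allP gl _ lQ)).
Qed.

Lemma path_rel_irrefl : irreflexive path_rel.
Proof.
move=> x; have [/path_rel_edges|/negbTE //] := boolP (path_rel x x).
by rewrite edges_pair (adj_irrefl G).
Qed.

Definition path_graph := SGraph path_rel_sym path_rel_irrefl.

Lemma path_graph_nth Q x0 i j : uniq (flatten l) -> Q \in l ->
  i < size Q -> j < size Q ->
  path_graph (nth x0 Q i) (nth x0 Q j) = (i.+1 == j) || (j.+1 == i).
Proof.
move=> ul lQ iQ jQ.
have uQ : uniq Q.
  by move: ul; rewrite (perm_uniq (perm_flatten (perm_to_rem lQ))) /= cat_uniq => /and3P[].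
apply/path_relP/idP => [[Q' lQ' nQ']|ij].
  have QQ' : Q' = Q.
    apply: (uniq_flatten_inj (x := nth x0 Q i) ul lQ' lQ _ (mem_nth _ iQ)).
    by apply: not_avoids_mem nQ' _; rewrite !inE eqxx.
  move: nQ'; rewrite QQ' => /(not_avoidsP x0)[k kQ /setP E].
  have kQ' := ltnW kQ.
  have := E (nth x0 Q k); have := E (nth x0 Q k.+1); have := E (nth x0 Q i).
  have := E (nth x0 Q j); rewrite !inE !nth_uniq //; lia.
exists Q => //; apply/(not_avoidsP x0).
case/orP: ij => /eqP ij; [exists i | exists j]; rewrite ?ij //.
by rewrite setUC.
Qed.

Lemma component_path_graph Q x : uniq (flatten l) -> Q \in l -> x \in Q ->
  component path_graph x = [set y in Q].
Proof.
move=> ul lQ xQ; apply/setP => y; rewrite !inE; apply/idP/idP => [xy|yQ].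
  rewrite -(closed_connect _ xy) //; apply: intro_closed.
    by apply: sym_connect_sym; apply: path_rel_sym.
  move=> a b /path_relP[Q' lQ' nQ'] aQ.
  have Q'P z : z \in [set a; b] -> z \in Q' by apply: not_avoids_mem nQ'.
  have -> : Q = Q' by apply: (uniq_flatten_inj (x := a) ul) => //; rewrite Q'P // !inE eqxx.
  by rewrite Q'P // !inE eqxx orbT.
have conn i : i < size Q -> connect path_graph (nth x Q 0) (nth x Q i).
  elim: i => // i IH iQ; apply: connect_trans (IH (ltnW iQ)) (connect1 _).
  by rewrite path_graph_nth ?eqxx // ltnW.
rewrite -(nth_index x xQ) -(nth_index x yQ).
apply: connect_trans (conn _ _); last by rewrite index_mem.
by rewrite (sym_connect_sym path_rel_sym); apply: conn; rewrite index_mem.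
Qed.

Lemma path_graph_factor k : perm_eq (flatten l) (enum T) ->
  {in l, forall Q, 0 < size Q -> k <= size Q} -> path_factor k G path_graph.
Proof.
move=> pl lk; have ul : uniq (flatten l) by rewrite (perm_uniq pl) enum_uniq.
split.
  by apply/subsetP => f /edgesP[x [y [xy ->]]]; apply: path_rel_edges.
move=> x; have : x \in flatten l by rewrite (perm_mem pl) mem_enum.
move=> /flattenP[Q lQ xQ]; exists (size Q).
  by apply: lk => //; case: (Q) xQ.
have uQ : uniq Q.
  by move: ul; rewrite (perm_uniq (perm_flatten (perm_to_rem lQ))) /= cat_uniq => /and3P[].
exists (fun i => nth x Q i); split.
- by move=> i j /eqP; rewrite nth_uniq // => /eqP/val_inj.
- rewrite (component_path_graph ul lQ xQ); apply/setP => y; rewrite inE.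
  apply/imsetP/idP => [[i _ ->]|yQ]; first exact: mem_nth.
  have iy : index y Q < size Q by rewrite index_mem.
  by exists (Ordinal iy); rewrite //= nth_index.
- by move=> i j; apply: path_graph_nth.
Qed.
End PathGraph.
End Partition.

(** * Deleting an edge *)

Section DeletedEdge.
Variables (T : finType) (G : sgraph T).

Lemma min_degree_le x : min_degree G <= degree G x.
Proof.
rewrite /min_degree; have : x \in index_enum T by rewrite mem_index_enum.
elim: (index_enum T) => //= y s IH; rewrite big_cons inE => /orP[/eqP->|/IH].
  exact: geq_minl.
exact: leq_trans (geq_minr _ _).
Qed.

Lemma del_edgeE e x y : del_edge G e x y = G x y && ([set x; y] != e).
Proof. by rewrite /del_edge /= /del_rel /= inE. Qed.

Lemma edge_eq e x y : e \in edges G -> x \in e -> y \in e -> x != y -> [set x; y] = e.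
Proof.
move=> /edgesP[p [q [_ ->]]] /set2P[]-> /set2P[]->; rewrite ?eqxx //.
by rewrite setUC.
Qed.

(** Only the other end of [e] can cease to be a neighbour of [x]. *)
Lemma degree_del_edge e x : e \in edges G ->
  degree G x <= degree (del_edge G e) x + (x \in e).
Proof.
move=> /edgesP[p [q [Gpq eE]]].
have pq : p != q by apply: contraTneq Gpq => ->; rewrite (adj_irrefl G).
apply: leq_trans (_ : #|[set y | del_edge G e x y] :|: [set y in e :\ x | x \in e]| <= _).
  apply: subset_leq_card; apply/subsetP => y; rewrite !inE => Gxy.
  have [eE'|ne] := eqVneq [set x; y] e; last by rewrite del_edgeE Gxy ne.
  apply/orP; right; rewrite -eE' !inE !eqxx !orbT !andbT.
  by apply: contraTneq Gxy => ->; rewrite (adj_irrefl G).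
apply: leq_trans (leq_card_setU _ _) _; rewrite leq_add2l.
have [xe|_] := boolP (x \in e); last first.
  by rewrite leqn0 cards_eq0; apply/eqP/setP => y; rewrite !inE andbF.
have : #|e| = 2 by rewrite eE cards2 pq.
rewrite (cardsD1 x e) xe => -[e1]; rewrite -[leqRHS]e1.
by apply: subset_leq_card; apply/subsetP => y; rewrite !inE andbT.
Qed.

(** Without the end [p] of [e], [A] cannot contain both ends of [e], so it is independent in [G] as
    well. *)
Lemma independent_del_edge e A : e \in edges G -> independent (del_edge G e) A ->
  #|A| <= (independence_number G).+1.
Proof.
move=> /edgesP[p [q [_ eE]]] /forall_inP iA.
have iA' : independent G (A :\ p).
  apply/forall_inP => x /setD1P[xp xA]; apply/forall_inP => y /setD1P[yp yA].
  have /forall_inP/(_ y yA) := iA x xA; apply: contra => Gxy; rewrite del_edgeE Gxy.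
  apply/eqP => /setP/(_ p); rewrite eE !inE eqxx eq_sym (negbTE xp).
  by rewrite eq_sym (negbTE yp).
rewrite (cardsD1 p) -addn1 addnC leq_add ?leq_b1 //.
by rewrite (leq_bigmax_cond _ iA').
Qed.
End DeletedEdge.

Theorem theorem1p3 (T : finType) (G : sgraph T) :
  edge_connected 2 G ->
  (((independence_number G)%:R + 4%:R) / 2%:R < (min_degree G)%:R :> rat)%R ->
  path_factor_uniform 3 G.
Proof.
move=> _ dG e eG f fG'.
have {}dG : independence_number G + 4 < (min_degree G).*2.
  rewrite Num.Theory.ltr_pdivrMr ?Num.Theory.ltr0n // in dG.
  by rewrite -GRing.natrD -GRing.natrM Num.Theory.ltr_nat muln2 in dG.
have [l pl opt] := exists_optimal fG'.
have /and3P[gl fl nl] := pl.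
(* Weight 0 means empty or at least three vertices, so the partition yields a factor; it contains
   [f] because some path runs through [f]. *)
have [/allP w0|] := boolP (all (fun Q => weight (size Q) == 0) l).
  exists (path_graph gl).
    apply: path_graph_factor fl _ => Q /w0.
    by case: (size Q) => [|[|[|]]].
  case/edgesP: fG' nl => x [y [_ ->]] nl; rewrite edges_pair.
  exact: nl.
move=> /allPn[R lR wR].
have R12 : 0 < size R <= 2 by case: (size R) wR => [|[|[|n]]] //; rewrite weight_ge3.
case: R => // x0 R in lR R12 wR *; set R0 := x0 :: R in lR R12 wR.
have pR : perm_eq l (R0 :: rem R0 l) := perm_to_rem lR.
have gR0 : sorted (del_edge G e) R0 by apply: (allP gl).
(* If [R] has two vertices, one of them is not an end of [e]; reverse [R] if
   necessary, to make it the last one. *)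
have [R' [sR' lR' pR' oR']] : exists R', [/\ size R' = size R0,
    size R' + (last x0 R' \in e) <= 2,
    path_partition (del_edge G e) f (R' :: rem R0 l) &
    optimal (del_edge G e) (avoids f) (R' :: rem R0 l)].
  have opt0 := optimal_perm pR opt.
  have pl0 : path_partition (del_edge G e) f (R0 :: rem R0 l).
    by rewrite /path_partition -!(perm_all _ pR) gl nl -(permPl (perm_flatten pR)) fl.
  have [lR0|lR0] := leqP (size R0 + (last x0 R0 \in e)) 2; first by exists R0.
  exists (rev R0); split; first exact: size_rev.
  - rewrite size_rev last_rev.
    move: lR0 gR0 R12; rewrite /R0; case: (R) => [|y [|]] //=.
      by case: (_ \in e).
    rewrite !andbT => ye dxy _; have : del_edge G e x0 y by [].
    rewrite del_edgeE => /andP[xy ne].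
    have {}ye : y \in e by move: ye; case: (y \in e).
    have [xe|//] := boolP (x0 \in e).
    by case/negP: ne; rewrite (edge_eq eG xe ye) //; apply: contraTneq xy => ->;
      rewrite (adj_irrefl G).
  - move: pl0; rewrite /path_partition /= !sorted_revE //.
    + by rewrite -(permPl (perm_cat (permEl (perm_rev R0)) (perm_refl _))).
    + exact: avoids_sym.
    + exact: del_rel_sym.
  - by apply: optimal_rev => //; apply: avoids_sym.
have [] := @optimal_independent _ _ _ fG' x0 _ _ oR' pR'; first by rewrite sR'.
move=> A iA dA; have dr := degree_del_edge (last x0 R') eG.
(* Let [c] be 1 if the last vertex of [R'] is in [e] and 0 otherwise, and [d'] its degree in
   [G - e]. Then [2 * min_degree G <= 2 * d' + 2 * c < #|A| + 2 * (size R' + c) <=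
   independence_number G + 5]. *)
suff : (min_degree G).*2 <= independence_number G + 4 by rewrite leqNgt dG.
have aA := independent_del_edge eG iA.
have dG' := leq_trans (min_degree_le G (last x0 R')) dr.
move: aA dG' dA.
move: (min_degree G) (independence_number G) (degree _ _) #|A| (size R') lR'.
case: (last x0 R' \in e) => /= d a d' A' k; clear; lia.
Qed.
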